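(* Let $p>2$ be a real number, let $A$ be a real symmetric $n\times n$ matrix with $\lambda_{\min}(A)<0$, and let $b\in\mathbb{R}^n$. Define, for $\lambda\ge 0$, \[ \Phi(\lambda)=\min_{z\ge 0}\{z^{p/2}-\lambda z\}=\lambda^{\frac{p}{p-2}}\left(\left(\tfrac{2}{p}\right)^{\frac{p}{p-2}}-\left(\tfrac{2}{p}\right)^{\frac{2}{p-2}}\right), \] which is concave on $[0,\infty)$. Then \[ \min_{x\in\mathbb{R}^n}\left\{x^TAx+b^Tx+\|x\|^p\right\} =\begin{cases} \displaystyle\sup_{\lambda>-\lambda_{\min}(A)}\ \Phi(\lambda)-\tfrac14 b^T(A+\lambda I)^{-1}b, & \text{if } b\notin\mathrm{Range}(A-\lambda_{\min}(A)I),\\[2mm] \displaystyle\sup_{\lambda\ge-\lambda_{\min}(A)}\ \Phi(\lambda)-\tfrac14 b^T(A+\lambda I)^{+}b, & \text{if } b\in\mathrm{Range}(A-\lambda_{\min}(A)I), \end{cases} \] and the univariate maximization problem on the right-hand side is a convex optimization problem, i.e. its objective is a concave function of $\lambda$ on the indicated interval.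
   Context: $\|\cdot\|$ is the Euclidean norm on $\mathbb{R}^n$, $\lambda_{\min}(A)$ is the smallest eigenvalue of $A$, $I$ is the identity matrix, $M^{+}$ is the Moore-Penrose generalized inverse of $M$, and $\mathrm{Range}(M)$ is the range (column space) of $M$. *)

(* Defs.v *)
From mathcomp Require Import all_boot all_order all_algebra.
From mathcomp Require Import all_classical all_reals all_analysis.

Set Implicit Arguments.
Unset Strict Implicit.
Unset Printing Implicit Defensive.

Import Order.TTheory GRing.Theory Num.Theory.

Local Open Scope classical_set_scope.
Local Open Scope ring_scope.

(* The norm `|x| that MathComp-Analysis puts on matrices is the sup norm. *)
Definition enorm (R : realType) (n : nat) (x : 'cV[R]_n) : R :=
  Num.sqrt (\sum_(i < n) x i ord0 ^+ 2).

(* The set of eigenvalues is finite, so the infimum is a minimum as soon as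
   there is an eigenvalue; if there is none then lambda_min A = inf set0 = 0. *)
Definition lambda_min (R : realType) (n : nat) (A : 'M[R]_n) : R :=
  inf [set l : R | eigenvalue A l].

Definition mxrange (R : realType) (m n : nat) (M : 'M[R]_(m, n)) :
  set 'cV[R]_m := range (fun y : 'cV[R]_n => M *m y).

Definition is_moore_penrose (R : realType) (m n : nat)
    (M : 'M[R]_(m, n)) (X : 'M[R]_(n, m)) : Prop :=
  [/\ M *m X *m M = M, X *m M *m X = X,
      (M *m X)^T = M *m X & (X *m M)^T = X *m M].

(* This is not pinvmx, which satisfies only some of the four equations. *)
Definition moore_penrose (R : realType) (m n : nat) (M : 'M[R]_(m, n)) :
  'M[R]_(n, m) := xget 0 [set X | is_moore_penrose M X].

Lemma mulmx_tr_eq0 (R : realType) (m n : nat) (B : 'M[R]_(m, n)) :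
  B *m B^T = 0 -> B = 0.
Proof.
move=> B0; apply/matrixP => i j; rewrite mxE.
have /matrixP /(_ i i) := B0; rewrite !mxE => /eqP.
rewrite psumr_eq0 => [/allP /(_ j)|k _]; last by rewrite mxE -expr2 sqr_ge0.
by rewrite mem_index_enum mxE mulf_eq0 orbb => /(_ isT) /eqP.
Qed.

Lemma row_free_gram_unit (R : realType) (m n : nat) (B : 'M[R]_(m, n)) :
  row_free B -> B *m B^T \in unitmx.
Proof.
move=> fB; rewrite -row_free_unit -kermx_eq0; apply/eqP.
set K := kermx _; have KB : K *m (B *m B^T) = 0 by apply: mulmx_ker.
have : K *m B = 0.
  by apply: mulmx_tr_eq0; rewrite trmx_mul mulmxA -(mulmxA K) KB mul0mx.
by move=> KB0; apply: (row_free_inj fB); rewrite KB0 mul0mx.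
Qed.

Lemma moore_penrose_uniq (R : realType) (m n : nat) (M : 'M[R]_(m, n))
    (X Y : 'M[R]_(n, m)) :
  is_moore_penrose M X -> is_moore_penrose M Y -> X = Y.
Proof.
move=> [X1 X2 X3 X4] [Y1 Y2 Y3 Y4].
have MXY : M *m X = M *m Y.
  by rewrite -X3 -{1}Y1 -mulmxA trmx_mul X3 Y3 mulmxA X1.
have XMY : X *m M = Y *m M.
  by rewrite -X4 -{1}Y1 -[M *m Y *m M]mulmxA mulmxA trmx_mul X4 Y4 -mulmxA
             [M *m _]mulmxA X1.
by rewrite -X2 -mulmxA MXY mulmxA XMY Y2.
Qed.

Lemma is_moore_penrose_factor (R : realType) (m n r : nat)
    (C : 'M[R]_(m, r)) (F : 'M[R]_(r, n)) :
  row_free C^T -> row_free F ->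
  is_moore_penrose (C *m F)
    (F^T *m invmx (F *m F^T) *m (invmx (C^T *m C) *m C^T)).
Proof.
move=> /row_free_gram_unit; rewrite trmxK => uC /row_free_gram_unit uF.
set P := invmx (F *m F^T); set Q := invmx (C^T *m C).
set X := F^T *m P *m (Q *m C^T).
have FP : F *m F^T *m P = 1%:M by rewrite mulmxV.
have QC : Q *m (C^T *m C) = 1%:M by rewrite mulVmx.
have PT : P^T = P by rewrite trmx_inv trmx_mul trmxK.
have QT : Q^T = Q by rewrite trmx_inv trmx_mul trmxK.
have MX : C *m F *m X = C *m (Q *m C^T).
  by rewrite /X -(mulmxA C) (mulmxA F) (mulmxA F) FP mul1mx.
have XM : X *m (C *m F) = F^T *m P *m F.
  by rewrite /X (mulmxA _ C) -(mulmxA _ (Q *m C^T)) -(mulmxA Q) QC mulmx1.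
split.
- by rewrite MX -!mulmxA (mulmxA C^T) (mulmxA Q) QC mul1mx.
- by rewrite XM /X -!mulmxA (mulmxA F) (mulmxA (F *m F^T)) FP mul1mx.
- by rewrite MX !trmx_mul QT trmxK mulmxA.
- by rewrite XM !trmx_mul PT trmxK mulmxA.
Qed.

Lemma moore_penroseP (R : realType) (m n : nat) (M : 'M[R]_(m, n)) :
  is_moore_penrose M (moore_penrose M).
Proof.
have fC : row_free (col_base M)^T.
  by rewrite /row_free mxrank_tr; exact: col_base_full.
have := is_moore_penrose_factor fC (row_base_free M).
rewrite mulmx_base => MX.
by apply: (@xgetPex _ 0 [set X | is_moore_penrose M X]); eexists; exact: MX.
Qed.

(* For 0 <= lambda and 2 < p this infimum is a minimum. *)
Definition Phi (R : realType) (p lambda : R) : R :=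
  inf [set z `^ (p / 2) - lambda * z | z in [set z : R | 0 <= z]].

Definition concave_function (R : realType) (D : set R) (f : R -> R) : Prop :=
  @convex_function R R^o D (fun x => - f x).

Definition primal_obj (R : realType) (n : nat) (p : R) (A : 'M[R]_n)
    (b x : 'cV[R]_n) : R :=
  (x^T *m A *m x) ord0 ord0 + (b^T *m x) ord0 ord0 + enorm x `^ p.

Definition dual_obj (R : realType) (n : nat) (p : R) (A : 'M[R]_n)
    (b : 'cV[R]_n) (lambda : R) : R :=
  Phi p lambda
  - 4^-1 * (b^T *m invmx (A + lambda%:M) *m b) ord0 ord0.

Definition dual_obj_mp (R : realType) (n : nat) (p : R) (A : 'M[R]_n)
    (b : 'cV[R]_n) (lambda : R) : R :=
  Phi p lambda
  - 4^-1 * (b^T *m moore_penrose (A + lambda%:M) *m b) ord0 ord0.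

(* Main.v *)
(** For [l >= 0], the inequality [z^(p/2) >= Phi l + l z] at [z = |x|^2] bounds
    the primal objective below by [Phi l] plus the quadratic
    [x^T (A + l I) x + b^T x]; minimizing the latter over [x] gives weak
    duality.  As a minimum over [(z, x)] of functions affine in [l], the dual
    objective is concave.

    The primal minimum is attained by coercivity, at some [x0 <> 0] because [A]
    has a negative eigenvalue.  With [m] the derivative of [z^(p/2)] at
    [|x0|^2], stationarity reads [2 (A + m I) x0 + b = 0], and comparing [x0]
    with the other points of its sphere shows that [A + m I] is positive
    semidefinite.  Hence [m >= - lambda_min A] and all the inequalities of weak
    duality are equalities at [(x0, m)]; moreover [m = - lambda_min A] would put
    [b] in the range of [A - lambda_min A I]. *)

Require Import Defs.
From mathcomp Require Import all_boot all_order all_algebra.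
From mathcomp Require Import all_classical all_reals all_analysis.
From mathcomp Require Import ring lra.

Set Implicit Arguments.
Unset Strict Implicit.
Unset Printing Implicit Defensive.

Import Order.TTheory GRing.Theory Num.Theory.
Import numFieldNormedType.Exports.

Local Open Scope classical_set_scope.
Local Open Scope ring_scope.

(** * Tangent inequality for powers and the values of [Phi] *)

Lemma powR_tangent (R : realType) (q z w : R) : 1 < q -> 0 <= z -> 0 <= w ->
  w `^ q + q * w `^ (q - 1) * (z - w) <= z `^ q.
Proof.
move=> q1 z0 w0; have q0 : 0 < q by lra.
have q10 : 0 < q - 1 by lra.
have qn0 : q != 0 by lra.
have q1n0 : q - 1 != 0 by lra.
(* Young's inequality for the product of [z] and [w^(q-1)], with conjugate exponents [q] and
   [q / (q - 1)]. Multiplied by [q], it becomes the tangent inequality. *)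
have := @conjugate_powR R z (w `^ (q - 1)) q (q / (q - 1)) z0 (powR_ge0 _ _) q0
  (divr_gt0 q0 q10).
rewrite -powRrM (_ : (q - 1) * (q / (q - 1)) = q); last by field.
have -> : q^-1 + (q / (q - 1))^-1 = 1 by field; rewrite qn0 q1n0.
move=> /(_ erefl) Y.
have wE := mulr_powRB1 w0 q0.
suff : q * (z * w `^ (q - 1)) <= z `^ q + (q - 1) * w `^ q by rewrite -wE; lra.
rewrite -(ler_pM2l q0) in Y; apply: (le_trans Y).
by rewrite le_eqVlt; apply/orP; left; apply/eqP; field; rewrite qn0 q1n0.
Qed.

Lemma inf_min (R : realType) (E : set R) (m : R) :
  E m -> lbound E m -> inf E = m.
Proof.
move=> Em lbm; apply/eqP; rewrite eq_le; apply/andP; split.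
- by apply: ge_inf => //; exists m.
- by apply: lb_le_inf => //; exists m.
Qed.

Lemma Phi_powR (R : realType) (p w : R) : 2 < p -> 0 <= w ->
  Phi p (p / 2 * w `^ (p / 2 - 1)) =
  w `^ (p / 2) - p / 2 * w `^ (p / 2 - 1) * w.
Proof.
move=> p2 w0; apply: inf_min; first by exists w.
move=> _ [z /= z0 <-]; have := @powR_tangent R (p / 2) z w _ z0 w0.
by move=> /(_ ltac:(lra)); lra.
Qed.

(** The base [(2 / p * lambda)^(2 / (p - 2))] is the point where [z^(p/2)] has derivative [lambda],
    so [Phi_powR] reaches every [lambda >= 0]. *)
Lemma Phi_slopeE (R : realType) (p lambda : R) : 2 < p -> 0 <= lambda ->
  p / 2 * ((2 / p * lambda) `^ (2 / (p - 2))) `^ (p / 2 - 1) = lambda.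
Proof.
move=> p2 l0; rewrite -powRrM (_ : 2 / (p - 2) * (p / 2 - 1) = 1).
  rewrite powRr1; first by field; lra.
  by rewrite mulr_ge0// divr_ge0//; lra.
by field; lra.
Qed.

Lemma PhiE (R : realType) (p lambda : R) (w := (2 / p * lambda) `^ (2 / (p - 2))) :
  2 < p -> 0 <= lambda -> Phi p lambda = w `^ (p / 2) - lambda * w.
Proof.
move=> p2 l0; have := @Phi_powR R p w p2 (powR_ge0 _ _).
by rewrite /w Phi_slopeE.
Qed.

Lemma Phi_min (R : realType) (p lambda : R) : 2 < p -> 0 <= lambda ->
  exists2 z : R, 0 <= z & z `^ (p / 2) - lambda * z = Phi p lambda.
Proof.
move=> p2 l0; exists ((2 / p * lambda) `^ (2 / (p - 2))); first exact: powR_ge0.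
by rewrite PhiE.
Qed.

Lemma Phi_le (R : realType) (p lambda z : R) : 2 < p -> 0 <= lambda -> 0 <= z ->
  Phi p lambda <= z `^ (p / 2) - lambda * z.
Proof.
move=> p2 l0 z0; rewrite PhiE//.
have := @powR_tangent R (p / 2) z ((2 / p * lambda) `^ (2 / (p - 2))) _ z0.
by move=> /(_ ltac:(lra) (powR_ge0 _ _)); rewrite Phi_slopeE//; lra.
Qed.

Lemma Phi_closed_form (R : realType) (p lambda : R) : 2 < p -> 0 <= lambda ->
  Phi p lambda = lambda `^ (p / (p - 2)) *
    ((2 / p) `^ (p / (p - 2)) - (2 / p) `^ (2 / (p - 2))).
Proof.
move=> p2 l0; rewrite PhiE//.
rewrite -powRrM (_ : 2 / (p - 2) * (p / 2) = p / (p - 2)); last first.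
  by field; lra.
have c0 : 0 <= 2 / p by rewrite divr_ge0//; lra.
have p0 : 0 <= p^-1 by rewrite invr_ge0; lra.
rewrite !powRM//.
(* Splitting off one factor [lambda] leaves the exponent [2 / (p - 2)], the one that occurs in
   [lambda * w]. *)
rewrite -(@mulr_powRB1 R lambda (p / (p - 2)))//; last by rewrite divr_gt0//; lra.
rewrite (_ : p / (p - 2) - 1 = 2 / (p - 2)); last by field; lra.
by ring.
Qed.

(** * Concavity of pointwise minima of affine functions *)

Lemma concave_min_affine (R : realType) (T : Type) (D : set R) (S : set T)
    (f : R -> R) (u v : T -> R) :
  (forall x y (t : {i01 R}), D x -> D y ->
    D (t%:num * x + (1 - t%:num) * y)) ->
  (forall x, D x -> exists2 s, S s & f x = u s + x * v s) ->
  (forall x s, D x -> S s -> f x <= u s + x * v s) ->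
  concave_function D f.
Proof.
move=> Dconv fmin fle t x y; rewrite !inE => Dx Dy.
rewrite !convRE /= /unstable.onem.
have t0 : 0 <= t%:num by [].
have t1 : t%:num <= 1 by [].
(* An index [s] that is optimal at the intermediate point also bounds [f] from above at [x] and [y];
   averaging these two bounds gives concavity. *)
have [s Ss ->] := fmin _ (Dconv x y t Dx Dy).
have := fle x s Dx Ss; have := fle y s Dy Ss.
set a := f x; set b := f y; set tt := t%:num in t0 t1 *.
by move=> *; nra.
Qed.

Lemma itv_conv_ge (R : realType) (c : R) (x y : R) (t : {i01 R}) :
  c <= x -> c <= y -> c <= t%:num * x + (1 - t%:num) * y.
Proof.
have t0 : 0 <= t%:num by [].
have t1 : t%:num <= 1 by [].
by set tt := t%:num in t0 t1 *; move=> *; nra.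
Qed.

Lemma itv_conv_gt (R : realType) (c : R) (x y : R) (t : {i01 R}) :
  c < x -> c < y -> c < t%:num * x + (1 - t%:num) * y.
Proof.
have t0 : 0 <= t%:num by [].
have t1 : t%:num <= 1 by [].
by set tt := t%:num in t0 t1 *; move=> cx cy; have [/eqP->|] := boolP (tt == 0); nra.
Qed.

Lemma Phi_concave (R : realType) (p : R) : 2 < p ->
  concave_function `[0, +oo[ (Phi p).
Proof.
move=> p2; apply: (@concave_min_affine R R _ [set z | 0 <= z] _
  (fun z => z `^ (p / 2)) (fun z => - z)).
- move=> x y t; rewrite /= !in_itv/= !andbT; exact: itv_conv_ge.
- move=> x; rewrite /= in_itv/= andbT => x0.
  by have [z z0 <-] := @Phi_min R p x p2 x0; exists z => //; rewrite mulrN.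
- move=> x s; rewrite /= in_itv/= andbT => x0 s0.
  by rewrite mulrN Phi_le.
Qed.

(** * Inner product and quadratic objectives *)

Definition dot (R : realType) (n : nat) (x y : 'cV[R]_n) : R :=
  (x^T *m y) ord0 ord0.

Lemma dotE (R : realType) (n : nat) (x y : 'cV[R]_n) :
  dot x y = \sum_(i < n) x i ord0 * y i ord0.
Proof. by rewrite /dot mxE; apply: eq_bigr => i _; rewrite mxE. Qed.

Lemma dotC (R : realType) (n : nat) (x y : 'cV[R]_n) : dot x y = dot y x.
Proof. by rewrite !dotE; apply: eq_bigr => i _; rewrite mulrC. Qed.

Lemma dotDr (R : realType) (n : nat) (x y z : 'cV[R]_n) :
  dot x (y + z) = dot x y + dot x z.
Proof. by rewrite /dot mulmxDr mxE. Qed.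

Lemma dotZr (R : realType) (n : nat) (a : R) (x y : 'cV[R]_n) :
  dot x (a *: y) = a * dot x y.
Proof. by rewrite /dot -scalemxAr mxE. Qed.

Lemma dotDl (R : realType) (n : nat) (x y z : 'cV[R]_n) :
  dot (x + y) z = dot x z + dot y z.
Proof. by rewrite dotC dotDr !(dotC z). Qed.

Lemma dotZl (R : realType) (n : nat) (a : R) (x y : 'cV[R]_n) :
  dot (a *: x) y = a * dot x y.
Proof. by rewrite dotC dotZr dotC. Qed.

Lemma dot0r (R : realType) (n : nat) (x : 'cV[R]_n) : dot x 0 = 0.
Proof. by rewrite /dot mulmx0 mxE. Qed.

Lemma dot_mulmx (R : realType) (n : nat) (M : 'M[R]_n) (x y : 'cV[R]_n) :
  dot x (M *m y) = dot (M^T *m x) y.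
Proof. by rewrite /dot trmx_mul trmxK mulmxA. Qed.

Lemma dotxx_ge0 (R : realType) (n : nat) (x : 'cV[R]_n) : 0 <= dot x x.
Proof. by rewrite dotE; apply: sumr_ge0 => i _; rewrite -expr2 sqr_ge0. Qed.

Lemma dotxx_eq0 (R : realType) (n : nat) (x : 'cV[R]_n) : dot x x = 0 -> x = 0.
Proof.
move=> /eqP; rewrite dotE psumr_eq0 => [/allP x0|i _]; last by rewrite -expr2 sqr_ge0.
apply/matrixP => i j; rewrite ord1 mxE; apply/eqP.
by have := x0 i (mem_index_enum _); rewrite /= mulf_eq0 orbb.
Qed.

Lemma dotxx_gt0 (R : realType) (n : nat) (x : 'cV[R]_n) : x != 0 -> 0 < dot x x.
Proof.
move=> x0; rewrite lt0r dotxx_ge0 andbT; apply: contra_neq x0; exact: dotxx_eq0.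
Qed.

Lemma mul_shift (R : realType) (n : nat) (A : 'M[R]_n) (l : R) (x : 'cV[R]_n) :
  (A + l%:M) *m x = A *m x + l *: x.
Proof. by rewrite mulmxDl mul_scalar_mx. Qed.

Lemma primal_objE (R : realType) (n : nat) (p : R) (A : 'M[R]_n)
    (b x : 'cV[R]_n) : p != 0 ->
  primal_obj p A b x = dot x (A *m x) + dot b x + dot x x `^ (p / 2).
Proof.
move=> p0; rewrite /primal_obj /dot mulmxA; congr (_ + _).
rewrite /enorm (_ : \sum_(i < n) _ = dot x x); last first.
  by rewrite dotE; apply: eq_bigr => i _; rewrite expr2.
by rewrite -powR12_sqrt ?dotxx_ge0// -powRrM mulrC.
Qed.

Definition psd (R : realType) (n : nat) (M : 'M[R]_n) : Prop :=
  forall d : 'cV[R]_n, 0 <= dot d (M *m d).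

Definition quad_obj (R : realType) (n : nat) (M : 'M[R]_n) (b x : 'cV[R]_n) : R :=
  dot x (M *m x) + dot b x.

Lemma quad_obj_shift (R : realType) (n : nat) (A : 'M[R]_n) (b x : 'cV[R]_n)
    (l : R) :
  quad_obj (A + l%:M) b x = quad_obj A b x + l * dot x x.
Proof. by rewrite /quad_obj mul_shift dotDr dotZr; ring. Qed.

(** The linear coefficient makes the gradient vanish at [y], so only the second-order term in [d]
    survives. *)
Lemma quad_obj_diff (R : realType) (n : nat) (M : 'M[R]_n) (y d : 'cV[R]_n) :
  M^T = M ->
  quad_obj M (- 2 *: (M *m y)) (y + d) =
  quad_obj M (- 2 *: (M *m y)) y + dot d (M *m d).
Proof.
move=> Ms; rewrite /quad_obj !mulmxDr !(dotDl, dotDr, dotZl, dotZr).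
by rewrite (dotC (M *m y) y) (dotC (M *m y) d) (dot_mulmx M y d) Ms
  (dotC (M *m y) d); ring.
Qed.

(** Both sides equal [- y^T M y]. The identity [M X M = M] is shared by [invmx] and [moore_penrose],
    so one formula serves both cases of the theorem. *)
Lemma quad_obj_ginv (R : realType) (n : nat) (M X : 'M[R]_n) (y : 'cV[R]_n)
    (b := - 2 *: (M *m y)) :
  M^T = M -> M *m X *m M = M ->
  quad_obj M b y = - (4^-1 * (b^T *m X *m b) ord0 ord0).
Proof.
move=> Ms MXM; rewrite -mulmxA -/(dot b (X *m b)) /quad_obj /b.
rewrite -scalemxAr !(dotZl, dotZr) [dot (M *m y) (X *m _)]dotC.
by rewrite (dot_mulmx M (X *m (M *m y)) y) Ms !mulmxA MXM (dotC y (M *m y)); field.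
Qed.

(** * First- and second-order conditions at a global minimizer *)

Lemma powR_continuous_at (R : realType) (r z : R) : 0 < z ->
  {for z, continuous (fun u : R => u `^ r)}.
Proof.
move=> z0; apply: differentiable_continuous; apply/derivable1_diffP.
by apply: derivable_powR; rewrite in_itv/= z0.
Qed.

Lemma ge0_at0_of_right (R : realType) (G : R -> R) :
  {for 0, continuous G} -> (forall t, 0 < t -> 0 <= G t) -> 0 <= G 0.
Proof.
move=> cG G0; rewrite leNgt; apply/negP => Gneg.
have /nbhs_ballP[e /= e0 eG] : \forall t \near (0 : R), G t < 0.
  exact: (cvgr_lt (G 0) cG).
have : G (e / 2) < 0.
  by apply: eG; rewrite /ball /= sub0r normrN gtr0_norm ?divr_gt0//; lra.
by rewrite ltNge G0// divr_gt0.
Qed.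

Lemma dot_line (R : realType) (n : nat) (x d : 'cV[R]_n) (t : R) :
  dot (x + t *: d) (x + t *: d) =
  dot x x + t * (2 * dot x d + t * dot d d).
Proof. by rewrite !(dotDl, dotDr, dotZl, dotZr) (dotC d x); ring. Qed.

Lemma quad_obj_line (R : realType) (n : nat) (A : 'M[R]_n) (b x d : 'cV[R]_n)
    (t : R) : A^T = A ->
  quad_obj A b (x + t *: d) =
  quad_obj A b x + t * (dot d (2 *: (A *m x) + b) + t * dot d (A *m d)).
Proof.
move=> As; rewrite /quad_obj mulmxDr -scalemxAr !(dotDl, dotDr, dotZl, dotZr).
by rewrite (dot_mulmx A x d) As (dotC (A *m x)) (dotC b d); ring.
Qed.

(* The derivative of [z `^ (p / 2)] at [z = |x|^2]. *)
Definition multiplier (R : realType) (n : nat) (p : R) (x : 'cV[R]_n) : R :=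
  p / 2 * dot x x `^ (p / 2 - 1).

(** Along each ray from [x0] the increase of the objective is nonnegative and at most [t * G t].
    Dividing by [t] and letting [t] tend to [0] makes every directional derivative nonnegative,
    hence the gradient zero. *)
Lemma primal_stationary (R : realType) (n : nat) (p : R) (A : 'M[R]_n)
    (b x0 : 'cV[R]_n) : 2 < p -> A^T = A -> x0 != 0 ->
  (forall x, primal_obj p A b x0 <= primal_obj p A b x) ->
  b = - 2 *: ((A + (multiplier p x0)%:M) *m x0).
Proof.
move=> p2 As x00 xmin; have z00 := dotxx_gt0 x00.
have p0 : p != 0 by rewrite gt_eqF//; lra.
set l := multiplier p x0.
have dir d : 0 <= dot d (2 *: (A *m x0) + b + (2 * l) *: x0).
  pose G t := dot d (2 *: (A *m x0) + b) + t * dot d (A *m d) +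
    p / 2 * (dot x0 x0 + t * (2 * dot x0 d + t * dot d d)) `^ (p / 2 - 1) *
    (2 * dot x0 d + t * dot d d).
  have -> : dot d (2 *: (A *m x0) + b + (2 * l) *: x0) = G 0.
    by rewrite /G !mul0r !addr0 (dotDr _ _ (_ *: x0)) dotZr (dotC d x0) /l /multiplier; ring.
  apply: ge0_at0_of_right.
    have cid : {for 0, continuous (fun t : R => t)} by exact: cvg_id.
    have ccst (c : R) : {for 0, continuous (fun _ : R => c)} by exact: cvg_cst.
    have clin : {for 0, continuous (fun t : R => 2 * dot x0 d + t * dot d d)}.
      by apply: cvgD; [exact: ccst|apply: cvgM; [exact: cid|exact: ccst]].
    apply: cvgD; first by apply: cvgD; [exact: ccst|apply: cvgM; [exact: cid|exact: ccst]].
    apply: cvgM; last exact: clin.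
    apply: cvgM; first exact: ccst.
    apply: (@continuous_comp _ _ _
      (fun t : R => dot x0 x0 + t * (2 * dot x0 d + t * dot d d))
      (fun u : R => u `^ (p / 2 - 1))).
      by apply: cvgD; [exact: ccst|apply: cvgM; [exact: cid|exact: clin]].
    by apply: powR_continuous_at; rewrite mul0r addr0.
  move=> t t0; rewrite -(pmulr_rge0 _ t0).
  have := xmin (x0 + t *: d); rewrite !primal_objE//.
  rewrite -!/(quad_obj _ _ _) quad_obj_line//.
  have : 0 <= dot (x0 + t *: d) (x0 + t *: d) by exact: dotxx_ge0.
  rewrite dot_line; set zt := dot x0 x0 + _ => zt0.
  (* The tangent is taken at the moved point [zt], which bounds the increase of [z^(p/2)] from
     above. *)
  have := @powR_tangent R (p / 2) (dot x0 x0) zt _ (ltW z00) zt0.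
  move=> /(_ ltac:(lra)); rewrite /G -/zt.
  have -> : dot x0 x0 - zt = - (t * (2 * dot x0 d + t * dot d d)) by rewrite /zt; ring.
  move: (zt `^ _) (zt `^ _) => u v; lra.
set g := 2 *: (A *m x0) + b + (2 * l) *: x0 in dir.
have g0 : g = 0.
  (* In the direction [- g] the directional derivative is [- |g|^2]. *)
  apply: dotxx_eq0; apply/eqP; rewrite eq_le dotxx_ge0 andbT.
  have := dir (- 1 *: g); rewrite dotZl; lra.
rewrite mul_shift scalerDr scalerA.
by apply/eqP; rewrite -subr_eq0 -g0 /g !scaleNr mulNr scaleNr opprD !opprK addrA
  (addrC b).
Qed.

(** On the sphere through [x0] the power term is constant, so [x0] minimizes there the quadratic
    with matrix [M = A + m I], which is stationary at [x0]. A chord [t d] from [x0] changes it by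
    [t^2 d^T M d], and every [d] not orthogonal to [x0] is the direction of a chord. *)
Lemma primal_psd (R : realType) (n : nat) (p : R) (A : 'M[R]_n)
    (b x0 : 'cV[R]_n) : 2 < p -> A^T = A -> x0 != 0 ->
  (forall x, primal_obj p A b x0 <= primal_obj p A b x) ->
  psd (A + (multiplier p x0)%:M).
Proof.
move=> p2 As x00 xmin; have z00 := dotxx_gt0 x00.
have p0 : p != 0 by rewrite gt_eqF//; lra.
have bE := primal_stationary p2 As x00 xmin.
set l := multiplier p x0 in bE *; set M := A + l%:M in bE *.
have Ms : M^T = M by rewrite linearD/= As tr_scalar_mx.
have sphere d : dot x0 d != 0 -> 0 <= dot d (M *m d).
  move=> xd; have d0 : d != 0 by apply: contra_neq xd => ->; rewrite dot0r.
  have dd := dotxx_gt0 d0.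
  (* [x0 + t d] is the reflection of [x0] in the hyperplane orthogonal to [d]. *)
  pose t : R := - (2 * dot x0 d) / dot d d.
  have zE : dot (x0 + t *: d) (x0 + t *: d) = dot x0 x0.
    by rewrite dot_line /t; field; rewrite gt_eqF.
  have := xmin (x0 + t *: d); rewrite !primal_objE//.
  rewrite -!/(quad_obj _ _ _) zE lerD2r.
  rewrite -(lerD2r (l * dot x0 x0)) -{2}zE -!quad_obj_shift -/M bE.
  rewrite quad_obj_diff// lerDl -scalemxAr dotZl dotZr mulrA -expr2.
  rewrite pmulr_rge0// exprn_even_gt0//= /t.
  by rewrite mulf_neq0 ?invr_neq0 ?(gt_eqF dd)// oppr_eq0 mulf_neq0.
move=> d; have [xd0|] := eqVneq (dot x0 d) 0; last exact: sphere.
(* [G e] is the quadratic form of [M] at [d + e x0], which is not orthogonal to [x0] when [e > 0];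
   the orthogonal [d] is its limit. *)
pose G e := dot d (M *m d) + e * (2 * dot x0 (M *m d) + e * dot x0 (M *m x0)).
have -> : dot d (M *m d) = G 0 by rewrite /G mul0r addr0.
apply: ge0_at0_of_right.
  have cid : {for 0, continuous (fun t : R => t)} by exact: cvg_id.
  have ccst (c : R) : {for 0, continuous (fun _ : R => c)} by exact: cvg_cst.
  apply: cvgD; first exact: ccst.
  apply: cvgM; first exact: cid.
  by apply: cvgD; [exact: ccst|apply: cvgM; [exact: cid|exact: ccst]].
move=> e e0; have := sphere (d + e *: x0).
rewrite dotDr dotZr xd0 add0r mulf_neq0 ?gt_eqF// => /(_ isT).
rewrite mulmxDr -scalemxAr !(dotDl, dotDr, dotZl, dotZr) (dot_mulmx M d x0) Ms.
by rewrite (dotC (M *m d) x0) /G; lra.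
Qed.

(** Adding the values at [t d] and [- t d] cancels the linear term, and for small [t] the negative
    quadratic term outweighs the one of order [t^p]. *)
Lemma primal_min_neq0 (R : realType) (n : nat) (p : R) (A : 'M[R]_n)
    (b x0 d : 'cV[R]_n) : 2 < p -> dot d (A *m d) < 0 ->
  (forall x, primal_obj p A b x0 <= primal_obj p A b x) -> x0 != 0.
Proof.
move=> p2 dneg xmin; apply/eqP => x00; subst x0.
have p0 : p != 0 by rewrite gt_eqF//; lra.
have p20 : p / 2 != 0 by rewrite mulf_neq0.
set a := dot d (A *m d) in dneg; set N := dot d d `^ (p / 2).
have N0 : 0 <= N by exact: powR_ge0.
have rayE s : primal_obj p A b (s *: d) =
    s ^+ 2 * a + s * dot b d + (s ^+ 2) `^ (p / 2) * N.
  rewrite primal_objE// -scalemxAr !(dotZl, dotZr) !mulrA -expr2.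
  by rewrite powRM ?dotxx_ge0 ?sqr_ge0.
have ray0 : primal_obj p A b 0 = 0.
  by rewrite -(scale0r d) rayE expr0n /= powR0// !mul0r !addr0.
have obj t : 0 < t -> 0 <= a + t `^ (p - 2) * N.
  move=> t0; have t2 : 0 < t ^+ 2 by exact: exprn_gt0.
  have tE : (t ^+ 2) `^ (p / 2) = t ^+ 2 * t `^ (p - 2).
    rewrite -(powR_mulrn 2 (ltW t0)) -powRrM -powRD; last first.
      by rewrite (gt_eqF t0) implybT.
    by congr (_ `^ _); field.
  have := xmin (t *: d); have := xmin (- t *: d).
  rewrite !rayE ray0 sqrrN tE => H1 H2; rewrite -(pmulr_rge0 _ t2); lra.
(* The test value of [t] satisfies [t^(p-2) = - a / (N + 1)], which turns the bound into
   [0 <= a / (N + 1)]. The summand [1] keeps the denominator positive. *)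
have c0 : 0 < - a / (N + 1) by rewrite divr_gt0//; lra.
have := obj _ (powR_gt0 (p - 2)^-1 c0).
rewrite -powRrM mulVf ?powRr1; [|exact: ltW|by rewrite gt_eqF//; lra].
have -> : a + - a / (N + 1) * N = a / (N + 1) by field; rewrite gt_eqF//; lra.
by rewrite leNgt pmulr_llt0 ?invr_gt0 ?dneg//; lra.
Qed.

(** * Continuity, coercivity and existence of a minimizer *)

Lemma sum_continuous (R : realType) (T : topologicalType) (I : Type)
    (r : seq I) (F : I -> T -> R) :
  (forall i, continuous (F i)) -> continuous (fun x => \sum_(i <- r) F i x).
Proof.
move=> Fc; apply: continuous_big; first exact: add_continuous.
by move=> i _; exact: Fc.
Qed.

(* The absolute value is needed: for [s < 0] the junk value of [s `^ r] is [1]. *)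
Lemma norm_powR_continuous (R : realType) (r : R) : 0 < r ->
  continuous (fun s : R => `|s| `^ r).
Proof.
move=> r0 s; have [->|s0] := eqVneq s 0; last first.
  apply: (@continuous_comp _ _ _ (fun s : R => `|s|) (fun u : R => u `^ r)).
    exact: norm_continuous.
  by apply: powR_continuous_at; rewrite normr_gt0.
apply/cvgrPdist_lt => e e0; rewrite normr0 powR0 ?gt_eqF//.
exists (e `^ r^-1); first exact: powR_gt0.
move=> t /=; rewrite !sub0r !normrN => te.
rewrite ger0_norm ?powR_ge0//.
have ltr := gt0_ltr_powR r0; have eN := powR_ge0 e r^-1.
rewrite -[ltRHS](_ : (e `^ r^-1) `^ r = e) ?ltr ?nnegrE//.
by rewrite -powRrM mulVf ?gt_eqF// powRr1 ?ltW.
Qed.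

Lemma dot_continuous (R : realType) (T : topologicalType) (n : nat)
    (f g : T -> 'cV[R]_n) :
  (forall i, continuous (fun v => f v i ord0)) ->
  (forall i, continuous (fun v => g v i ord0)) ->
  continuous (fun v => dot (f v) (g v)).
Proof.
move=> cf cg; under eq_fun do rewrite dotE.
by apply: sum_continuous => i x; apply: cvgM; [exact: cf|exact: cg].
Qed.

(** The map [f] will be transposition, because the extreme value theorem is applied to row
    vectors. *)
Lemma primal_continuous (R : realType) (T : topologicalType) (n : nat) (p : R)
    (A : 'M[R]_n) (b : 'cV[R]_n) (f : T -> 'cV[R]_n) : 0 < p ->
  (forall i, continuous (fun v => f v i ord0)) ->
  continuous (fun v => primal_obj p A b (f v)).
Proof.
move=> p0 cf.
have -> : (fun v => primal_obj p A b (f v)) = (fun v =>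
    dot (f v) (A *m f v) + dot b (f v) + `|dot (f v) (f v)| `^ (p / 2)).
  apply/funext => v; rewrite primal_objE ?gt_eqF//.
  by rewrite [in RHS]ger0_norm ?dotxx_ge0.
have cAf i : continuous (fun v => (A *m f v) i ord0).
  under eq_fun do rewrite mxE.
  by apply: sum_continuous => j y; apply: cvgM; [exact: cvg_cst|exact: cf].
have cb i : continuous (fun _ : T => b i ord0) by move=> y; exact: cvg_cst.
move=> x; apply: cvgD.
  apply: cvgD; first exact: (dot_continuous cf cAf).
  exact: (@dot_continuous R T n (fun=> b) f cb cf).
apply: (@continuous_comp _ _ _ (fun v => dot (f v) (f v))
  (fun s : R => `|s| `^ (p / 2))); first exact: dot_continuous.
by apply: norm_powR_continuous; rewrite divr_gt0.
Qed.

Lemma quad_lower_bound (R : realType) (n : nat) (A : 'M[R]_n) :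
  exists2 C : R, 0 <= C & forall x, - C * dot x x <= dot x (A *m x).
Proof.
exists (\sum_(i < n) \sum_(j < n) `|A i j|) => [|x].
  by apply: sumr_ge0 => i _; apply: sumr_ge0.
have xi_le i : x i ord0 ^+ 2 <= dot x x.
  rewrite dotE (bigD1 i)//= -expr2 lerDl; apply: sumr_ge0 => j _.
  by rewrite -expr2 sqr_ge0.
have -> : dot x (A *m x) = \sum_(i < n) \sum_(j < n) A i j * (x i ord0 * x j ord0).
  rewrite dotE; apply: eq_bigr => i _; rewrite mxE mulr_sumr.
  by apply: eq_bigr => j _; ring.
rewrite mulNr mulr_suml -sumrN; apply: ler_sum => i _.
rewrite mulr_suml -sumrN; apply: ler_sum => j _.
have xy : `|x i ord0 * x j ord0| <= dot x x.
  rewrite ler_norml; have := xi_le i; have := xi_le j.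
  by move=> *; apply/andP; split; nra.
rewrite lerNl; apply: le_trans (ler_wpM2l (normr_ge0 (A i j)) xy).
by rewrite -normrM -[leRHS]normrN ler_norm.
Qed.

(** Using [Phi] at [C + 1] absorbs the bound [- C |x|^2] and leaves a spare [|x|^2]. Half of it
    controls the linear term, through [|x + b|^2 >= 0]. *)
Lemma primal_lower_bound (R : realType) (n : nat) (p : R) (A : 'M[R]_n)
    (b : 'cV[R]_n) : 2 < p ->
  exists K : R, forall x, 2^-1 * dot x x - K <= primal_obj p A b x.
Proof.
move=> p2; have [C C0 CA] := quad_lower_bound A.
exists (2^-1 * dot b b - Phi p (C + 1)) => x.
have p0 : p != 0 by rewrite gt_eqF//; lra.
rewrite primal_objE//.
have C10 : 0 <= C + 1 by lra.
have := Phi_le p2 C10 (dotxx_ge0 x); have := CA x.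
have := dotxx_ge0 (x + b); rewrite !(dotDl, dotDr) (dotC x b).
set z := dot x x; move: (z `^ _) (Phi _ _) => u v; lra.
Qed.

Lemma primal_min_exists (R : realType) (n : nat) (p : R) (A : 'M[R]_n)
    (b : 'cV[R]_n) : 2 < p ->
  exists x0, forall x, primal_obj p A b x0 <= primal_obj p A b x.
Proof.
move=> p2; have [K Kle] := @primal_lower_bound R n p A b p2.
(* Outside the box [|x|^2 >= r^2 >= r], and [r / 2 - K] exceeds the objective at [0]. *)
set r : R := 1 + 2 * (`|K| + `|primal_obj p A b 0|).
have r1 : 1 <= r by rewrite lerDl mulr_ge0// addr_ge0.
pose box := [set v : 'rV[R]_n | forall i, `[- r, r]%classic (v ord0 i)].
have box0 : box 0.
  by move=> i; rewrite /= mxE in_itv/=; apply/andP; split; lra.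
have cptbox : compact box.
  by apply: (rV_compact (A := fun=> `[- r, r]%classic)) => i; exact: segment_compact.
have [||c /set_mem cbox cmin] := @EVT_min_rV R n
    (fun v => primal_obj p A b v^T) box _ cptbox.
- by exists 0.
- apply: continuous_subspaceT; apply: primal_continuous; first lra.
  by move=> i; under eq_fun do rewrite mxE; exact: coord_continuous.
exists c^T => x.
have [xbox|nxbox] := pselect (box x^T).
  by have := cmin _ (mem_set xbox); rewrite trmxK.
have := cmin _ (mem_set box0); rewrite trmx0 => /le_trans; apply.
move/existsNP: nxbox => [i]; rewrite /= in_itv/= mxE => /negP xi.
have rx : r ^+ 2 <= dot x x.
  rewrite dotE (bigD1 i)//= -expr2 -[leLHS]addr0 lerD//; last first.
    by apply: sumr_ge0 => j _; rewrite -expr2 sqr_ge0.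
  by move: xi; rewrite negb_and -!ltNge => /orP[] ?; nra.
apply: le_trans (Kle x); have := ler_norm K; have := ler_norm (primal_obj p A b 0).
have : r <= r ^+ 2 by rewrite expr2 ler_peMl//; lra.
rewrite {1}/r; lra.
Qed.

(** * The smallest eigenvalue and the shifts of [A] *)

Lemma eigenvalue_col (R : realType) (n : nat) (A : 'M[R]_n) (l : R) :
  A^T = A -> eigenvalue A l <-> exists2 v : 'cV[R]_n, v != 0 & A *m v = l *: v.
Proof.
move=> As; split => [/eigenvalueP[v vA v0]|[v v0 Av]].
- by exists v^T; rewrite ?trmx_eq0// -{1}As -trmx_mul vA linearZ.
- apply/eigenvalueP; exists v^T; last by rewrite trmx_eq0.
  by rewrite -{1}As -trmx_mul Av linearZ.
Qed.

Lemma dot_shift_eigen (R : realType) (n : nat) (A : 'M[R]_n) (l c : R)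
    (v : 'cV[R]_n) : A *m v = l *: v ->
  dot v ((A + c%:M) *m v) = (l + c) * dot v v.
Proof. by move=> Av; rewrite mul_shift Av -scalerDl dotZr. Qed.

(* The optimality conditions of the case [p = 3], [b = 0] show that the
   infimum of the eigenvalues is attained and give the Rayleigh bound. *)
Lemma lambda_min_spec (R : realType) (n : nat) (A : 'M[R]_n) :
  A^T = A -> lambda_min A < 0 ->
  (exists2 v : 'cV[R]_n, v != 0 & A *m v = lambda_min A *: v) /\
  psd (A + (- lambda_min A)%:M).
Proof.
move=> As l0.
(* Otherwise [lambda_min A] would be nonnegative, as an infimum of nonnegative numbers or as the
   default value [inf set0 = 0]. *)
have [l [/(eigenvalue_col _ As) [v v0 Av] lneg]] :
    exists l, eigenvalue A l /\ l < 0.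
  apply: contrapT => /forallNP ev; move: l0; apply/negP; rewrite -leNgt /lambda_min.
  have [->|/set0P ne] := eqVneq [set l | eigenvalue A l] set0; first by rewrite inf0.
  apply: lb_le_inf => // l /= Al; rewrite leNgt; apply/negP => lneg.
  by apply: (ev l).
have p2 : (2 : R) < 3 by lra.
have [x0 xmin] := @primal_min_exists R n 3 A 0 p2.
have vneg : dot v (A *m v) < 0.
  by rewrite Av dotZr pmulr_llt0 ?dotxx_gt0.
have x00 := primal_min_neq0 p2 vneg xmin.
have M0 := primal_stationary p2 As x00 xmin.
have Mpsd := primal_psd p2 As x00 xmin.
set m := multiplier 3 x0 in M0 Mpsd.
have Ax0 : A *m x0 = - m *: x0.
  (* With [b = 0], stationarity makes [x0] an eigenvector for [- m]. *)
  have /eqP : - 2 *: ((A + m%:M) *m x0) = 0 by rewrite -M0.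
  rewrite scaler_eq0 oppr_eq0 pnatr_eq0/= mul_shift addr_eq0 => /eqP ->.
  by rewrite scaleNr.
have -> : lambda_min A = - m.
  apply: inf_min => [|k /= /(eigenvalue_col _ As) [w w0 Aw]].
    by apply/(eigenvalue_col _ As); exists x0.
  have := Mpsd w; rewrite (dot_shift_eigen _ Aw) pmulr_lge0 ?dotxx_gt0//; lra.
by rewrite opprK; split => //; exists x0.
Qed.

Lemma shift_psd (R : realType) (n : nat) (A : 'M[R]_n) (c l : R) :
  psd (A + c%:M) -> c <= l -> psd (A + l%:M).
Proof.
move=> Apsd cl d; have := Apsd d; rewrite !mul_shift !(dotDr, dotZr).
by have := dotxx_ge0 d; nra.
Qed.

Lemma shift_unit (R : realType) (n : nat) (A : 'M[R]_n) (c l : R) :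
  A^T = A -> psd (A + c%:M) -> c < l -> A + l%:M \in unitmx.
Proof.
move=> As Apsd cl; rewrite unitmxE unitfE; apply/negP => /det0P[v v0 vM].
have Mv : (A + l%:M) *m v^T = 0.
  by rewrite -[LHS]trmxK trmx_mul trmxK linearD/= As tr_scalar_mx vM trmx0.
have vT0 : v^T != 0 by rewrite trmx_eq0.
have := Apsd v^T.
(* On a kernel vector of [A + l I] the form of [A + c I] would be [(c - l) |v|^2 < 0]. *)
rewrite (_ : A + c%:M = A + l%:M + (c - l)%:M); last first.
  by rewrite -addrA -raddfD/= subrKC.
rewrite mul_shift Mv add0r dotZr; have := dotxx_gt0 vT0; nra.
Qed.

(** * Weak and strong duality, for any generalized inverse [X l] of [A + l I] on [D] *)

Section Duality.
Variables (R : realType) (n : nat) (p : R) (A : 'M[R]_n) (b : 'cV[R]_n).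
Variables (D : set R) (X : R -> 'M[R]_n).
Hypotheses (p_gt2 : 2 < p) (A_sym : A^T = A).
Hypothesis D_conv : forall x y (t : {i01 R}), D x -> D y ->
  D (t%:num * x + (1 - t%:num) * y).
Hypothesis D_ge0 : forall l, D l -> 0 <= l.
Hypothesis D_psd : forall l, D l -> psd (A + l%:M).
Hypothesis D_range : forall l, D l -> mxrange (A + l%:M) b.
Hypothesis X_ginv : forall l, D l ->
  (A + l%:M) *m X l *m (A + l%:M) = A + l%:M.

Let dual l := Phi p l - 4^-1 * (b^T *m X l *m b) ord0 ord0.

Let shift_sym l : (A + l%:M)^T = A + l%:M.
Proof. by rewrite linearD/= A_sym tr_scalar_mx. Qed.

Lemma dualE l y : D l -> b = - 2 *: ((A + l%:M) *m y) ->
  dual l = Phi p l + (quad_obj A b y + l * dot y y).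
Proof.
move=> Dl bE; rewrite -quad_obj_shift /dual {1 2}bE.
by rewrite -quad_obj_ginv ?X_ginv// -bE.
Qed.

Lemma dual_min l : D l ->
  exists y, dual l = Phi p l + (quad_obj A b y + l * dot y y).
Proof.
(* The factor [- 2^-1] turns a preimage of [b] into a stationary point of the quadratic. *)
move=> Dl; have [y _ yb] := D_range Dl; exists (- 2^-1 *: y).
by apply: dualE => //; rewrite -scalemxAr scalerA mulrNN divff// scale1r yb.
Qed.

Lemma dual_le l x : D l -> dual l <= Phi p l + (quad_obj A b x + l * dot x x).
Proof.
move=> Dl; have [y _ yb] := D_range Dl.
have bE : b = - 2 *: ((A + l%:M) *m (- 2^-1 *: y)).
  by rewrite -scalemxAr scalerA mulrNN divff// scale1r yb.
rewrite (dualE Dl bE) lerD2l -!quad_obj_shift.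
set y' := _ *: y in bE *; rewrite -(subrKC y' x) bE.
by rewrite quad_obj_diff// lerDl; exact: D_psd.
Qed.

Lemma dual_concave : concave_function D dual.
Proof.
(* A pair [s = (z, x)] collects the variable of [Phi] and that of the quadratic, which are minimized
   independently. *)
apply: (@concave_min_affine R (R * 'cV[R]_n) _ [set s | 0 <= s.1] _
  (fun s => s.1 `^ (p / 2) + quad_obj A b s.2)
  (fun s => dot s.2 s.2 - s.1)) => // l.
- move=> Dl; have [z z0 zE] := Phi_min p_gt2 (D_ge0 Dl).
  by have [y ->] := dual_min Dl; exists (z, y) => //=; rewrite -zE; ring.
- move=> [z x] Dl /= z0; have := dual_le x Dl.
  by have := Phi_le p_gt2 (D_ge0 Dl) z0; lra.
Qed.

Lemma strong_duality (x0 : 'cV[R]_n) : x0 != 0 ->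
  (forall x, primal_obj p A b x0 <= primal_obj p A b x) ->
  D (multiplier p x0) ->
  (primal_obj p A b x0)%:E = ereal_sup [set (dual l)%:E | l in D].
Proof.
move=> x00 xmin Dm; have p0 : p != 0 by rewrite gt_eqF// (lt_trans _ p_gt2).
apply/eqP; rewrite eq_le; apply/andP; split.
(* The multiplier is the slope of [z^(p/2)] at [|x0|^2], so [Phi] is attained there, while [x0]
   attains the minimum of the shifted quadratic. *)
- apply: ereal_sup_ubound; exists (multiplier p x0) => //; congr (_%:E).
  rewrite (dualE Dm (primal_stationary p_gt2 A_sym x00 xmin)).
  by rewrite Phi_powR ?dotxx_ge0// primal_objE// -/(quad_obj _ _ _) /multiplier; ring.
- apply: ge_ereal_sup => _ [l Dl <-]; rewrite lee_fin.
  rewrite primal_objE// -/(quad_obj _ _ _); have := dual_le x0 Dl.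
  by have := Phi_le p_gt2 (D_ge0 Dl) (dotxx_ge0 x0); lra.
Qed.

End Duality.

Theorem mainTheorem2 (R : realType) (n : nat) (p : R) (A : 'M[R]_n)
    (b : 'cV[R]_n) (p_gt2 : 2 < p) (A_sym : A^T = A)
    (lmin_lt0 : lambda_min A < 0) :
  (forall lambda : R, 0 <= lambda ->
    (exists2 z : R, 0 <= z & z `^ (p / 2) - lambda * z = Phi p lambda) /\
    (forall z : R, 0 <= z -> Phi p lambda <= z `^ (p / 2) - lambda * z) /\
    Phi p lambda = lambda `^ (p / (p - 2)) *
      ((2 / p) `^ (p / (p - 2)) - (2 / p) `^ (2 / (p - 2)))) /\
  concave_function `[0, +oo[ (Phi p) /\
  exists x0 : 'cV[R]_n,
    (forall x : 'cV[R]_n, primal_obj p A b x0 <= primal_obj p A b x) /\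
    (~ mxrange (A - (lambda_min A)%:M) b ->
      (primal_obj p A b x0)%:E =
        ereal_sup [set (dual_obj p A b lambda)%:E |
                    lambda in `]- lambda_min A, +oo[] /\
      concave_function `]- lambda_min A, +oo[ (dual_obj p A b)) /\
    (mxrange (A - (lambda_min A)%:M) b ->
      (primal_obj p A b x0)%:E =
        ereal_sup [set (dual_obj_mp p A b lambda)%:E |
                    lambda in `[- lambda_min A, +oo[] /\
      concave_function `[- lambda_min A, +oo[ (dual_obj_mp p A b)).
Proof.
split.
  move=> l l0; split; first exact: Phi_min.
  by split => [z z0|]; [exact: Phi_le|exact: Phi_closed_form].
split; first exact: Phi_concave.
have [[v v0 Av] Apsd] := lambda_min_spec A_sym lmin_lt0.
set c := lambda_min A in lmin_lt0 Av Apsd *.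
have [x0 xmin] := @primal_min_exists R n p A b p_gt2.
exists x0; split => //.
have vneg : dot v (A *m v) < 0 by rewrite Av dotZr pmulr_llt0 ?dotxx_gt0.
have x00 := primal_min_neq0 p_gt2 vneg xmin.
have bE := primal_stationary p_gt2 A_sym x00 xmin.
(* Semidefiniteness is tested on an eigenvector for [lambda_min A]. *)
have mge : - c <= multiplier p x0.
  have := primal_psd p_gt2 A_sym x00 xmin v.
  by rewrite (dot_shift_eigen _ Av) pmulr_lge0 ?dotxx_gt0//; lra.
split => [nrange|range_b].
- have unitD l : l \in `]- c, +oo[ -> A + l%:M \in unitmx.
    by rewrite in_itv/= andbT; exact: shift_unit.
  have Dge0 l : l \in `]- c, +oo[ -> 0 <= l by rewrite in_itv/= andbT; lra.
  have Dpsd l : l \in `]- c, +oo[ -> psd (A + l%:M).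
    by rewrite in_itv/= andbT => /ltW; exact: shift_psd.
  have Drange l : l \in `]- c, +oo[ -> mxrange (A + l%:M) b.
    by move=> /unitD uM; exists (invmx (A + l%:M) *m b) => //; rewrite mulKVmx.
  have Dginv l : l \in `]- c, +oo[ ->
      (A + l%:M) *m invmx (A + l%:M) *m (A + l%:M) = A + l%:M.
    by move=> /unitD uM; rewrite mulmxV// mul1mx.
  have Dconv x y (t : {i01 R}) : x \in `]- c, +oo[ -> y \in `]- c, +oo[ ->
      t%:num * x + (1 - t%:num) * y \in `]- c, +oo[.
    by rewrite !in_itv/= !andbT; exact: itv_conv_gt.
  split; last exact: (dual_concave p_gt2 A_sym Dconv Dge0 Dpsd Drange Dginv).
  apply: (strong_duality p_gt2 A_sym Dge0 Dpsd Drange Dginv) => //.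
  (* If the multiplier were [- c], stationarity would give [b = (A - c I) (- 2 x0)], against
     [nrange]. *)
  rewrite /= in_itv/= andbT lt_neqAle mge andbT; apply/eqP => cm; apply: nrange.
  by exists (- 2 *: x0) => //; rewrite -scalemxAr -raddfN/= cm.
- have Dge0 l : l \in `[- c, +oo[ -> 0 <= l by rewrite in_itv/= andbT; lra.
  have Dpsd l : l \in `[- c, +oo[ -> psd (A + l%:M).
    by rewrite in_itv/= andbT; exact: shift_psd.
  have Drange l : l \in `[- c, +oo[ -> mxrange (A + l%:M) b.
    (* The hypothesis on [b] covers the endpoint [- c]; beyond it the shifted matrix is
       invertible. *)
    rewrite in_itv/= andbT le_eqVlt => /predU1P[<-|cl]; first by rewrite raddfN.
    have uM := shift_unit A_sym Apsd cl.
    by exists (invmx (A + l%:M) *m b) => //; rewrite mulKVmx.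
  have Dginv l : l \in `[- c, +oo[ ->
      (A + l%:M) *m moore_penrose (A + l%:M) *m (A + l%:M) = A + l%:M.
    by move=> _; have [] := moore_penroseP (A + l%:M).
  have Dconv x y (t : {i01 R}) : x \in `[- c, +oo[ -> y \in `[- c, +oo[ ->
      t%:num * x + (1 - t%:num) * y \in `[- c, +oo[.
    by rewrite !in_itv/= !andbT; exact: itv_conv_ge.
  split; last exact: (dual_concave p_gt2 A_sym Dconv Dge0 Dpsd Drange Dginv).
  apply: (strong_duality p_gt2 A_sym Dge0 Dpsd Drange Dginv) => //.
  by rewrite /= in_itv/= andbT.
Qed.
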